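(* Let $M$ be a compact metric space, and let $\widetilde\Theta:\mathrm{Conf}_n(M)\to|\mathsf{SymType}|$ be the map given by $\widetilde\Theta(X)=[\mathrm{Sym}(X)]$. For each $\omega\in|\mathsf{SymType}|$, denote $$\mathrm{Conf}_n^{\omega}(M)=\{X\in\mathrm{Conf}_n(M)\mid\widetilde\Theta(X)=\omega\}.$$ Then: (i) The space $\mathrm{Conf}_n(M)$ admits a disjoint decomposition into these subsets, $$\mathrm{Conf}_n(M)=\bigsqcup_{\omega\in|\mathsf{SymType}|}\mathrm{Conf}_n^{\omega}(M).$$ (ii) For any $\omega,\omega'\in|\mathsf{SymType}|$, if $\overline{\mathrm{Conf}_n^{\omega}(M)}\cap\mathrm{Conf}_n^{\omega'}(M)\neq\emptyset$, then $\omega\leq\omega'$ in the natural partial order on $|\mathsf{SymType}|$.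
   Context: $\mathrm{Conf}_n(M)$ is the unordered configuration space of subsets of $n$ distinct points of $M$, with its usual topology; the bar denotes closure in $\mathrm{Conf}_n(M)$. $\mathrm{Iso}(M)$ is the isometry group of $M$ and $\mathrm{Sym}(X)=\{g\in\mathrm{Iso}(M)\mid g(X)=X\}$. $|\mathsf{SymType}|$ is the set of conjugacy classes $[H]$ of closed subgroups $H$ of $\mathrm{Iso}(M)$. Its natural partial order is: $[H]\leq[H']$ if there exists $g\in\mathrm{Iso}(M)$ with $gHg^{-1}\leq H'$. *)

(* Defs.v *)
From HB Require Import structures.
From mathcomp Require Import all_boot all_order all_algebra finmap.
From mathcomp Require Import all_classical all_reals all_analysis.

Set Implicit Arguments.
Unset Strict Implicit.
Unset Printing Implicit Defensive.

Import Order.TTheory GRing.Theory Num.Theory.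
Local Open Scope classical_set_scope.
Local Open Scope ring_scope.
Local Open Scope card_scope.

Section IsometryGroup.
Context {R : realType} (M : metricType R).

Definition isometries : set {compact-open, M -> M} :=
  [set f | bijective f /\ forall x y, mdist (f x) (f y) = mdist x y].

(* Iso carries the subspace topology of the compact-open topology, which is the
   topology of uniform convergence when M is compact. *)
Definition Iso : Type := isometries.

HB.instance Definition _ := Topological.copy Iso (isometries : Type).

Definition iso_fun (g : Iso) : M -> M := set_val g.
Coercion iso_fun : Iso >-> Funclass.

Lemma iso_inj (g : Iso) : injective g.
Proof. by case: g => f /= /[dup] /set_mem[/bij_inj]. Qed.

Lemma iso_bij (g : Iso) : bijective g.
Proof. by case: g => f /= /[dup] /set_mem[]. Qed.

Lemma iso_dist (g : Iso) (x y : M) : mdist (g x) (g y) = mdist x y.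
Proof. by case: g => f /= /[dup] /set_mem[]. Qed.

Lemma iso_ext (g h : Iso) : g =1 h -> g = h.
Proof. by move=> gh; apply/val_inj/funext. Qed.

Lemma iso_id_subproof : (id : M -> M) \in isometries.
Proof. by rewrite inE; split => //; exists id. Qed.

Lemma iso_comp_subproof (g h : Iso) : (g \o h : M -> M) \in isometries.
Proof.
by rewrite inE; split=> [|x y /=]; [exact: bij_comp (iso_bij g) (iso_bij h)
  | rewrite !iso_dist].
Qed.

Lemma iso_inv_ex (g : Iso) : exists f : M -> M, cancel g f /\ cancel f g.
Proof. by have [f] := iso_bij g; exists f. Qed.

Definition iso_inv_fun (g : Iso) : M -> M := projT1 (cid (iso_inv_ex g)).

Lemma iso_funK (g : Iso) : cancel g (iso_inv_fun g).
Proof. by rewrite /iso_inv_fun; case: cid => f []. Qed.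

Lemma iso_inv_funK (g : Iso) : cancel (iso_inv_fun g) g.
Proof. by rewrite /iso_inv_fun; case: cid => f []. Qed.

Lemma iso_inv_subproof (g : Iso) : (iso_inv_fun g : M -> M) \in isometries.
Proof.
rewrite inE; split=> [|x y /=]; last by rewrite -(iso_dist g) !iso_inv_funK.
by exists g; [exact: iso_inv_funK | exact: iso_funK].
Qed.

Definition iso_id : Iso := SigSub iso_id_subproof.
Definition iso_comp (g h : Iso) : Iso := SigSub (iso_comp_subproof g h).
Definition iso_inv (g : Iso) : Iso := SigSub (iso_inv_subproof g).

Lemma iso_compA : associative iso_comp.
Proof. by move=> f g h; exact: iso_ext. Qed.
Lemma iso_comp1g : left_id iso_id iso_comp.
Proof. by move=> f; exact: iso_ext. Qed.
Lemma iso_compg1 : right_id iso_id iso_comp.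
Proof. by move=> f; exact: iso_ext. Qed.
Lemma iso_compVg : left_inverse iso_id iso_inv iso_comp.
Proof. by move=> f; apply: iso_ext; exact: iso_funK. Qed.
Lemma iso_compgV : right_inverse iso_id iso_inv iso_comp.
Proof. by move=> f; apply: iso_ext; exact: iso_inv_funK. Qed.

HB.instance Definition _ := isGroup.Build Iso
  iso_compA iso_comp1g iso_compg1 iso_compVg iso_compgV.

Lemma iso_eval_continuous (x : M) : continuous (fun g : Iso => g x).
Proof.
apply/continuousP => O oO.
exists [set f : {compact-open, M -> M} | f @` [set x] `<=` O].
  by apply: compact_open_open => //; exact: compact_set1.
apply/seteqP; split=> g /=; first by apply; exists x.
by move=> gO _ [_ -> <-].
Qed.

End IsometryGroup.

Section SymmetryTypes.
Local Open Scope group_scope.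
Context {R : realType} (M : metricType R).

Definition closed_subgroup (H : set (Iso M)) : Prop :=
  group_closed [in H] /\ closed H.

Definition conj_subgroup (g : Iso M) (H : set (Iso M)) : set (Iso M) :=
  [set g * h * g^-1 | h in H].

Definition conj_class (H : set (Iso M)) : set (set (Iso M)) :=
  [set conj_subgroup g H | g in [set: Iso M]].

(* A symmetry type is a conjugacy class, represented as a set of subgroups. *)
Definition SymType : Type := [set conj_class H | H in closed_subgroup].

Definition sym_type (H : set (Iso M)) (clH : closed_subgroup H) : SymType :=
  SigSub (mem_set (imageP conj_class clH)).

Definition sym_type_le (w w' : SymType) : Prop :=
  exists (H H' : set (Iso M)) (clH : closed_subgroup H)
    (clH' : closed_subgroup H'),
    [/\ w = sym_type clH, w' = sym_type clH'
      & exists g : Iso M, conj_subgroup g H `<=` H'].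

Lemma conj_subgroup1 (H : set (Iso M)) : conj_subgroup 1 H = H.
Proof.
rewrite /conj_subgroup; under eq_imagel do rewrite mul1g invg1 mulg1.
exact: image_id.
Qed.

Lemma conj_subgroupM (g h : Iso M) (H : set (Iso M)) :
  conj_subgroup g (conj_subgroup h H) = conj_subgroup (g * h) H.
Proof.
rewrite /conj_subgroup image_comp; apply: eq_imagel => k _ /=.
by rewrite invgM !mulgA.
Qed.

Lemma conj_subgroupS (g : Iso M) (H K : set (Iso M)) :
  H `<=` K -> conj_subgroup g H `<=` conj_subgroup g K.
Proof. exact: image_subset. Qed.

Lemma sym_type_eqP (H K : set (Iso M)) (clH : closed_subgroup H)
    (clK : closed_subgroup K) :
  sym_type clH = sym_type clK <-> exists g, conj_subgroup g H = K.
Proof.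
split=> [/(congr1 val)/= HK|[g gHK]].
  have : conj_class K K by exists 1 => //; exact: conj_subgroup1.
  by rewrite -HK => -[g _ gHK]; exists g.
apply/val_inj => /=; apply/seteqP; split=> _ [k _ <-].
  by exists (k * g^-1) => //; rewrite -gHK conj_subgroupM -mulgA mulVg mulg1.
by exists (k * g) => //; rewrite -gHK conj_subgroupM.
Qed.

(* The order does not depend on the representatives of the classes. *)
Lemma sym_type_leP (H H' : set (Iso M)) (clH : closed_subgroup H)
    (clH' : closed_subgroup H') :
  sym_type_le (sym_type clH) (sym_type clH') <->
  exists g, conj_subgroup g H `<=` H'.
Proof.
split=> [|sub]; last by exists H, H', clH, clH'.
move=> [K [K' [clK [clK' [/sym_type_eqP[a aHK] /esym/sym_type_eqP[b bKH]]]]]].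
move=> [g gKK']; exists (b * (g * a)).
rewrite -!conj_subgroupM aHK -bKH; exact: conj_subgroupS.
Qed.

End SymmetryTypes.

Section ConfigurationSpace.
Context {R : realType} (M : metricType R) (n : nat).

(* Injective n-tuples of points, as a subspace of the product M^n. *)
Definition OrdConf : Type :=
  [set x : {ptws 'I_n -> M} | injective x].

HB.instance Definition _ := Topological.copy OrdConf
  ([set x : {ptws 'I_n -> M} | injective x] : Type).

Definition Conf : Type := [set X : set M | X #= `I_n].

Definition conf_set (X : Conf) : set M := set_val X.

Definition ord_conf_fun (x : OrdConf) : 'I_n -> M := set_val x.

Lemma ord_conf_inj (x : OrdConf) : injective (ord_conf_fun x).
Proof. by case: x => f /= /[dup] /set_mem. Qed.

Lemma card_conf_subproof (x : OrdConf) :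
  range (ord_conf_fun x) \in [set X : set M | X #= `I_n].
Proof.
rewrite inE /= (card_eqr card_II); apply: inj_card_eq.
by move=> i j _ _; exact: ord_conf_inj.
Qed.

Definition conf_of (x : OrdConf) : Conf := SigSub (card_conf_subproof x).

Lemma conf_of_surj (X : Conf) : exists x : OrdConf, conf_of x = X.
Proof.
case: X => X XP; have := XP; rewrite inE /= (card_eqr card_II) => /card_esym.
move=> /(card_bijP (B := X))[f [f' fK f'K]].
have fI : injective (fun i : 'I_n => val (f (SigSub (mem_set (I : setT i))))).
  by move=> i j /val_inj/(can_inj fK)/(congr1 val).
exists (SigSub (mem_set fI : _ \in [set x : {ptws 'I_n -> M} | injective x])).
apply/val_inj/seteqP; split=> [_ [i _ <-] /=|x Xx].
  exact: set_mem (valP (f _)).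
exists (val (f' (SigSub (mem_set Xx)))) => //=.
transitivity (val (f (f' (SigSub (mem_set Xx))))); last by rewrite f'K.
by rewrite /ord_conf_fun /=; congr (val (f _)); exact: val_inj.
Qed.

Definition conf_repr (X : Conf) : OrdConf := projT1 (cid (conf_of_surj X)).

Lemma conf_reprK : cancel conf_repr conf_of.
Proof. by move=> X; rewrite /conf_repr; case: cid. Qed.

HB.instance Definition _ := isQuotient.Build OrdConf Conf conf_reprK.

(* The quotient topology for the map forgetting the order, i.e. for the action
   of the symmetric group on injective n-tuples. *)
HB.instance Definition _ := Topological.copy Conf (quotient_topology Conf).

End ConfigurationSpace.

Section SymmetryStratification.
Context {R : realType} (M : metricType R) (n : nat).

Definition Sym (X : set M) : set (Iso M) := [set g : Iso M | g @` X = X].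

Lemma closed_subgroup_Sym (X : Conf M n) : closed_subgroup (Sym (conf_set X)).
Proof.
have finX : finite_set (conf_set X) by exists n; exact: set_mem (valP X).
split; first split.
- by rewrite inE; exact: image_id.
- move=> g h /[!inE] /= gX hX.
  have hVX : iso_fun (h^-1)%g @` conf_set X = conf_set X.
    rewrite -[in LHS]hX image_comp -[RHS]image_id; apply: eq_imagel => x _.
    exact: iso_funK.
  transitivity (iso_fun g @` (iso_fun (h^-1)%g @` conf_set X)); last by rewrite hVX.
  by rewrite image_comp.
suff -> : Sym (conf_set X) =
    \bigcap_(x in conf_set X) ((fun g : Iso M => g x) @^-1` conf_set X).
  apply: closed_bigI => x _; apply: preimage_closed.
    by move=> g _; exact: iso_eval_continuous.
  have /accessible_finite_set_closed closedF : accessible_space M.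
    by apply: hausdorff_accessible; exact: metric_hausdorff.
  exact: closedF.
apply/seteqP; split=> [g gX x Xx /=|g gX /=].
  by rewrite -[X in X (g x)]gX; exists x.
have gXX : g @` conf_set X `<=` conf_set X by move=> _ [x Xx <-]; exact: gX.
have fin_gX := finite_image g finX.
suff /eqP : fset_set (g @` conf_set X) == fset_set (conf_set X).
  exact: fset_set_inj.
rewrite eqEfcard; apply/andP; split; first by rewrite -fset_set_sub.
by rewrite fset_set_image// card_imfset//; exact: iso_inj.
Qed.

Definition Theta (X : Conf M n) : SymType M :=
  sym_type (closed_subgroup_Sym X).

Definition Conf_stratum (w : SymType M) : set (Conf M n) :=
  [set X | Theta X = w].

End SymmetryStratification.

Arguments Conf_stratum {R M} n w.

(* Main.v *)
Require Import Defs.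
From mathcomp Require Import all_boot all_order all_algebra finmap.
From mathcomp Require Import all_classical all_reals all_analysis.
From mathcomp Require Import lra.
Local Open Scope classical_set_scope.

(** The decomposition (i) only says that [Theta] is a function. For (ii), let
    [X] have symmetry type [w'] and be a limit of configurations [Y] of type
    [w]. Fix one configuration [Y0] of type [w] with symmetry group [H]; each
    nearby [Y] of type [w] has [Sym Y = g_Y H g_Y^-1] for some isometry [g_Y].
    Because [M] is compact, the isometries [g_Y] have a pointwise limit [g]
    along an ultrafilter refining the approach of [Y] to [X]
    ([ultra_iso_limit]), and [g] is again an isometry. For [h] in [H] the
    symmetry [g_Y h g_Y^-1] of [Y] tends to [g h g^-1], and a limit of
    symmetries of configurations tending to [X] is a symmetry of [X]
    ([Sym_limit]). Hence [g H g^-1] is contained in [Sym X], that is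
    [w <= w'].

    Pointwise convergence of isometries suffices throughout, because isometries
    are uniformly equicontinuous: pointwise limits are compatible with
    composition and inversion ([iso_cvgM], [iso_cvgV]). The topology of the
    configuration space enters only through two families of open sets: the
    configurations that meet, respectively that lie inside, a given open set of
    [M] ([conf_hit_open], [conf_inside_open]). *)

Set Implicit Arguments.
Unset Strict Implicit.
Unset Printing Implicit Defensive.

Import Order.TTheory GRing.Theory Num.Theory.
Import metricType_numDomainType.
Local Open Scope ring_scope.

(** * Pointwise limits of isometries *)

Lemma ultra_fmap (T U : Type) (f : T -> U) (F : set_system T) :
  UltraFilter F -> UltraFilter (f @ F).
Proof.
move=> FU; split=> [|G GP FG]; first exact: fmap_proper_filter.
apply/seteqP; split=> // B GB.
have [//|FnB] := in_ultra_setVsetC (f @^-1` B) FU.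
have GnB : G (~` B) by apply: FG.
by have [y []] := filter_ex (filterI GB GnB).
Qed.

Section IsoLimits.
Context {R : realType} (M : metricType R).

Definition iso_cvg (T : Type) (F : set_system T) (k : T -> Iso M) (u : Iso M) :=
  forall x : M, k t x @[t --> F] --> u x.

Lemma iso_invKV (u : Iso M) : cancel (iso_fun u^-1%g) u.
Proof. exact: iso_inv_funK. Qed.

Section Operations.
Context (T : Type) (F : set_system T) {FF : Filter F}.

Lemma iso_cvg_cst (u : Iso M) : iso_cvg F (fun=> u) u.
Proof. by move=> x; exact: cvg_cst. Qed.

(** The distance from [k t (l t x)] to [k t (v x)] equals that from [l t x] to
    [v x], so it tends to zero although [k t] varies with [t]. *)
Lemma iso_cvgM (k l : T -> Iso M) (u v : Iso M) :
  iso_cvg F k u -> iso_cvg F l v ->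
  iso_cvg F (fun t => (k t * l t)%g) (u * v)%g.
Proof.
move=> ku lv x; apply/cvgrPdist_lt => e e0.
have e2 : 0 < e / 2 by rewrite divr_gt0.
apply: filterS2 (cvgr_dist_lt (lv x) e2) (cvgr_dist_lt (ku (v x)) e2).
move=> t vl uk.
rewrite [e]splitr; apply: le_lt_trans (metric_triangle _ (k t (v x)) _) _.
by apply: ltrD; rewrite // iso_dist.
Qed.

(** The distance from [(k t)^-1 x] to [u^-1 x] equals that from [x] to
    [k t (u^-1 x)]. *)
Lemma iso_cvgV (k : T -> Iso M) (u : Iso M) :
  iso_cvg F k u -> iso_cvg F (fun t => (k t)^-1)%g (u^-1)%g.
Proof.
move=> ku x; apply/cvgrPdist_lt => e e0.
apply: (filterS _ (cvgr_dist_lt (ku (iso_fun u^-1%g x)) e0)) => t.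
by rewrite -(iso_dist (k t) (iso_fun u^-1%g x)) !iso_invKV metric_sym.
Qed.

End Operations.

Lemma mdist_cvg_cst (T : Type) (F : set_system T) {FF : ProperFilter F}
    (a b : T -> M) (x y : M) (c : R) :
  a @ F --> x -> b @ F --> y -> (forall t, mdist (a t) (b t) = c) ->
  mdist x y = c.
Proof.
move=> ax b_y abc; apply/eqP; rewrite eq_le; apply/andP.
suff close e : 0 < e -> mdist x y <= c + e /\ c <= mdist x y + e.
  by split; apply/ler_addgt0Pr => e /close[].
move=> e0; have e2 : 0 < e / 2 by rewrite divr_gt0.
have /filter_ex[t [xa yb]] :
    F [set t | mdist x (a t) < e / 2 /\ mdist y (b t) < e / 2].
  by apply: filterI; exact: cvgr_dist_lt.
move: (metric_triangle x (a t) y) (metric_triangle (a t) (b t) y).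
move: (metric_triangle (a t) x (b t)) (metric_triangle x y (b t)).
move: xa yb; rewrite abc (metric_sym (b t) y) (metric_sym (a t) x).
lra.
Qed.

(** Compactness of the isometry group in the form needed here: along an
    ultrafilter the values at each point converge because [M] is compact, and
    the limits of the inverses provide an inverse of the limit. *)
Lemma ultra_iso_limit (compactM : compact [set: M]) (T : Type)
    (F : set_system T) (k : T -> Iso M) :
  UltraFilter F -> exists u : Iso M, iso_cvg F k u.
Proof.
move=> FU.
have ptlim (l : T -> Iso M) :
    exists f : M -> M, forall x, l t x @[t --> F] --> f x.
  suff lim x : exists y : M, l t x @[t --> F] --> y.
    by have [f fl] := boolp.choice lim; exists f.
  have := compactM; rewrite compact_ultra => /(_ _ _).
  move=> /(_ _ (ultra_fmap (fun t => l t x) FU))[|y [_ ly]]; last by exists y.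
  exact: filterT.
have [f fk] := ptlim k; have [f' f'k] := ptlim (fun t => (k t)^-1%g).
have fiso x y : mdist (f x) (f y) = mdist x y.
  by apply: mdist_cvg_cst (fk x) (fk y) _ => t; exact: iso_dist.
have fK : cancel f f'.
  move=> x; apply: mdist_positivity.
  suff kx : iso_fun (k t)^-1%g (f x) @[t --> F] --> x.
    by apply: mdist_cvg_cst (f'k (f x)) kx _ => t; exact: mdistxx.
  apply/cvgrPdist_lt => e e0; apply: (filterS _ (cvgr_dist_lt (fk x) e0)) => t.
  by rewrite -(iso_dist (k t) x) iso_invKV metric_sym.
have f'K : cancel f' f.
  move=> x; apply: mdist_positivity.
  suff kx : k t (f' x) @[t --> F] --> x.
    by apply: mdist_cvg_cst (fk (f' x)) kx _ => t; exact: mdistxx.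
  apply/cvgrPdist_lt => e e0; apply: (filterS _ (cvgr_dist_lt (f'k x) e0)) => t.
  by rewrite -(iso_dist (k t) (f' x)) iso_invKV metric_sym.
have fI : f \in @isometries R M by rewrite inE; split => //; exists f'.
by exists (SigSub fI).
Qed.

End IsoLimits.

(** * Open sets of configurations *)

Section ConfTopology.
Context {R : realType} (M : metricType R) (n : nat).

Lemma ord_conf_continuous (i : 'I_n) :
  continuous (fun o : OrdConf M n => ord_conf_fun o i).
Proof.
move=> o; apply: (@continuous_comp _ {ptws 'I_n -> M} _
  (fun o : OrdConf M n => ord_conf_fun o) (fun f => f i)).
  exact: initial_continuous.
exact: proj_continuous.
Qed.

Lemma conf_openE (U : set (Conf M n)) :
  open U = open ((@conf_of R M n) @^-1` U).
Proof.
have -> : @conf_of R M n = (\pi_(Conf M n))%qT by rewrite unlock.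
by [].
Qed.

Lemma conf_hit_open (O : set M) : open O ->
  open [set Y : Conf M n | conf_set Y `&` O !=set0].
Proof.
move=> oO; rewrite conf_openE.
rewrite (_ : _ @^-1` _ =
    \bigcup_i ((fun o : OrdConf M n => ord_conf_fun o i) @^-1` O)).
  apply: bigcup_open => i _; apply: open_comp => // o _.
  exact: ord_conf_continuous.
apply/seteqP; split=> [c [_ [[i _ <-] Oi]]|c [i _ Oi]]; first by exists i.
by exists (ord_conf_fun c i); split => //; exists i.
Qed.

Lemma conf_inside_open (O : set M) : open O ->
  open [set Y : Conf M n | conf_set Y `<=` O].
Proof.
move=> oO; rewrite conf_openE.
rewrite (_ : _ @^-1` _ = \big[setI/setT]_(i < n)
    ((fun o : OrdConf M n => ord_conf_fun o i) @^-1` O)).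
  elim/big_ind: _ => [|A B|i _]; [exact: openT|exact: openI|].
  by apply: open_comp => // o _; exact: ord_conf_continuous.
rewrite -bigcap_seq; apply/seteqP; split=> [c cO i _|c cO _ [i _ <-]] /=.
  by apply: cO; exists i.
by apply: (cO i); exact: mem_index_enum.
Qed.

End ConfTopology.

(** * Upper semicontinuity of the symmetry type *)

Section SymLimits.
Context {R : realType} (M : metricType R) (n : nat).

Lemma conf_finite (X : Conf M n) : finite_set (conf_set X).
Proof. by exists n; exact: set_mem (valP X). Qed.

Lemma conf_closed (X : Conf M n) : closed (conf_set X).
Proof.
have /accessible_finite_set_closed : accessible_space M.
  by apply: hausdorff_accessible; exact: metric_hausdorff.
by apply; exact: conf_finite.
Qed.

Lemma SymV (X : set M) (g : Iso M) : Sym X g -> Sym X g^-1%g.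
Proof.
move=> gX; rewrite /Sym /= -[in LHS]gX image_comp -[RHS]image_id.
by apply: eq_imagel => x _; exact: iso_funK.
Qed.

Section Limit.
Context (F : set_system (Conf M n)) {FF : ProperFilter F} (X : Conf M n)
  (FX : F --> X).

(** A point [x] of [X] is approached by points [y] of [Y], whose images
    [k Y y] lie in [Y], hence are close to [X]; meanwhile [k Y y] is close to
    [k Y x], which tends to [u x]. *)
Lemma limit_stabilizes (k : Conf M n -> Iso M) (u : Iso M) :
  iso_cvg F k u -> (\forall Y \near F, Sym (conf_set Y) (k Y)) ->
  forall x, conf_set X x -> conf_set X (u x).
Proof.
move=> ku kSym x Xx; apply: conf_closed => B /nbhs_ballP[e /= e0 eB].
have e3 : 0 < e / 3 by rewrite divr_gt0.
pose O : set M := \bigcup_(z in conf_set X) (ball z (e / 3))°.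
have nearX : F [set Y | conf_set Y `<=` O].
  apply/FX/open_nbhs_nbhs; split.
    by apply/conf_inside_open/bigcup_open => z _; exact: open_interior.
  move=> z Xz; exists z => //.
  by case: (open_nbhs_ball z (PosNum e3)).
have meetx : F [set Y | conf_set Y `&` (ball x (e / 3))° !=set0].
  apply/FX/open_nbhs_nbhs; split.
    by apply: conf_hit_open; exact: open_interior.
  by exists x; split => //; case: (open_nbhs_ball x (PosNum e3)).
have kx : F [set Y | mdist (u x) (k Y x) < e / 3] by exact: cvgr_dist_lt.
have [Y [[YO [y [Yy /interior_subset xy]]] [kY uk]]] :=
  filter_ex (filterI (filterI nearX meetx) (filterI kSym kx)).
have /YO[z Xz /interior_subset zky] : conf_set Y (k Y y).
  by rewrite -[X in X _]kY; exists y.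
exists z; split => //; apply: eB.
move: xy zky uk; rewrite !ballEmdist /= -(iso_dist (k Y) x).
rewrite (metric_sym z).
move: (metric_triangle (u x) (k Y x) z) (metric_triangle (k Y x) (k Y y) z).
lra.
Qed.

(** [limit_stabilizes] for [k] gives [u X] inside [X], and for the inverses of
    [k], which are symmetries too, the reverse inclusion. *)
Lemma Sym_limit (k : Conf M n -> Iso M) (u : Iso M) :
  iso_cvg F k u -> (\forall Y \near F, Sym (conf_set Y) (k Y)) ->
  Sym (conf_set X) u.
Proof.
move=> ku kSym; apply/seteqP; split=> [_ [x Xx <-]|x Xx].
  exact: limit_stabilizes ku kSym x Xx.
exists (iso_fun u^-1%g x); last exact: iso_invKV.
apply: limit_stabilizes (iso_cvgV ku) _ x Xx.
by apply: filterS kSym => Y; exact: SymV.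
Qed.

End Limit.

End SymLimits.

Theorem theorem2p1p7 (R : realType) (M : metricType R) (n : nat)
    (compactM : compact [set: M]) :
  ([set: Conf M n] = \bigcup_(w in [set: SymType M]) Conf_stratum n w
   /\ trivIset [set: SymType M] (Conf_stratum n))
  /\ (forall w w' : SymType M,
        closure (Conf_stratum n w) `&` Conf_stratum n w' !=set0 ->
        sym_type_le w w').
Proof.
split; first split.
- by apply/seteqP; split=> // X _; exists (Theta X).
- by move=> w w' _ _ [X [<- <-]].
move=> w w' [X [clX <-]].
have [Y0 [Y0w _]] := clX _ filterT.
rewrite -Y0w; apply/sym_type_leP.
pose H := Sym (conf_set Y0).
have /boolp.choice[k kP] : forall Y : Conf M n, exists g : Iso M,
    Conf_stratum n w Y -> conj_subgroup g H = Sym (conf_set Y).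
  move=> Y; have [Yw|nYw] := pselect (Conf_stratum n w Y); last by exists 1%g.
  have /sym_type_eqP[g gE] : Theta Y0 = Theta Y by rewrite Y0w Yw.
  by exists g.
have wP : ProperFilter (within (Conf_stratum n w) (nbhs X)).
  exact: within_nbhs_proper.
have [F [FU wF]] := ultraFilterLemma wP.
have [g kg] := ultra_iso_limit compactM k FU.
exists g => _ [h Hh <-].
apply: (@Sym_limit _ _ _ F _ X _ (fun Y => (k Y * h * (k Y)^-1)%g)).
- by move=> A XA; apply: wF; apply: filterS XA => Y AY _.
- apply: iso_cvgM (iso_cvgV kg); apply: iso_cvgM kg _.
  exact: iso_cvg_cst.
- apply: wF; apply: nearW => Y Yw.
  by rewrite -(kP Y Yw); exists h.
Qed.
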